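(* Let $d\ge 1$ and let $(X_N)_{N\in\mathbb{N}}$ be a sequence of point sets $X_N\subset\mathbb{S}^d$ with $\#X_N=N$, which is hyperuniform for small caps. Then $(X_N)_{N\in\mathbb{N}}$ is (asymptotically) uniformly distributed on $\mathbb{S}^d$.
   Context: $\mathbb{S}^d\subset\mathbb{R}^{d+1}$ is the unit sphere, $\langle\cdot,\cdot\rangle$ the Euclidean inner product, and $\sigma$ the normalised ($\sigma(\mathbb{S}^d)=1$) surface area measure on $\mathbb{S}^d$. For $\mathbf{x}\in\mathbb{S}^d$ and $\phi\in[0,\pi]$, the spherical cap is $C(\mathbf{x},\phi)=\{\mathbf{y}\in\mathbb{S}^d : \langle\mathbf{x},\mathbf{y}\rangle>\cos\phi\}$; its measure $\sigma(C(\cdot,\phi))$ does not depend on the centre. Number variance: for an $N$-point set $X_N\subset\mathbb{S}^d$, $$V(X_N,\phi)=\int_{\mathbb{S}^d}\bigl(\#(X_N\cap C(\mathbf{x},\phi))-N\sigma(C(\cdot,\phi))\bigr)^2\,\mathrm{d}\sigma(\mathbf{x}).$$ Hyperuniform for small caps: $V(X_N,\phi_N)=o\bigl(N\sigma(C(\cdot,\phi_N))\bigr)$ as $N\to\infty$ for all sequences $(\phi_N)_{N\in\mathbb{N}}$ of opening angles such that $\lim_{N\to\infty}\phi_N=0$ and $\lim_{N\to\infty}N\sigma(C(\cdot,\phi_N))=\infty$ (the latter being equivalent to $\phi_N N^{1/d}\to\infty$). (Asymptotically) uniformly distributed on $\mathbb{S}^d$: for all $\mathbf{x}\in\mathbb{S}^d$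 and $\phi\in[0,\pi]$, $\lim_{N\to\infty}\frac1N\#(X_N\cap C(\mathbf{x},\phi))=\sigma(C(\mathbf{x},\phi))$. *)

(* Defs.v *)
From HB Require Import structures.
From mathcomp Require Import all_boot all_order all_algebra finmap.
From mathcomp Require Import all_classical all_reals all_analysis measurable_realfun.

Set Implicit Arguments.
Unset Strict Implicit.
Unset Printing Implicit Defensive.
From mathcomp Require Import ring lra.
Import Order.TTheory GRing.Theory Num.Theory.
Import numFieldNormedType.Exports.

Local Open Scope classical_set_scope.
Local Open Scope ring_scope.

Definition rV_display : measure_display.
Proof. exact: default_measure_display. Qed.

Section measurable_rV.
Context {R : realType} (n : nat).

(* The product sigma-algebra, i.e. the Borel sigma-algebra of R^n. *)
Let coor (i : 'I_n) (v : 'rV[R]_n) : measurableTypeR R := v ord0 i.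

Let rV_set0 : g_sigma_preimage coor set0.
Proof. exact: sigma_algebra0. Qed.

Let rV_setC A : g_sigma_preimage coor A -> g_sigma_preimage coor (~` A).
Proof. exact: sigma_algebraC. Qed.

Let rV_bigcup (F : (set 'rV[R]_n)^nat) :
  (forall i, g_sigma_preimage coor (F i)) ->
  g_sigma_preimage coor (\bigcup_i (F i)).
Proof. exact: sigma_algebra_bigcup. Qed.

HB.instance Definition _ := @isMeasurable.Build rV_display 'rV[R]_n
  (g_sigma_preimage coor) rV_set0 rV_setC rV_bigcup.

End measurable_rV.

Section measurable_rV_theory.
Context {R : realType}.

Lemma measurable_coor n (i : 'I_n) :
  measurable_fun [set: 'rV[R]_n] (fun v => v ord0 i : measurableTypeR R).
Proof.
move=> _ Y mY; rewrite setTI; apply: sub_sigma_algebra => /=.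
rewrite -bigcup_seq/=; exists i => /=; first by rewrite mem_index_enum.
by exists Y => //; rewrite setTI.
Qed.

Lemma measurable_fun_rV d (T : measurableType d) n (f : T -> 'rV[R]_n) :
  (forall i, measurable_fun [set: T] (fun x => f x ord0 i : measurableTypeR R)) ->
  measurable_fun [set: T] f.
Proof.
move=> mf _ A mA; rewrite setTI.
have : g_sigma_preimage
    (fun i => (fun v : 'rV[R]_n => v ord0 i : measurableTypeR R) \o f)
    (f @^-1` A).
  by rewrite g_sigma_preimage_comp; exists A => //; rewrite setTI.
apply: smallest_sub; first exact: sigma_algebra_measurable.
case: n => [|n] in f mf A mA *; first by rewrite big_ord0.
rewrite -bigcup_mkord_ord; apply: bigcup_sub => i Ii.
by move=> B [C mC <-]; exact: mf.
Qed.

Definition rV_cons n (p : measurableTypeR R * 'rV[R]_n) : 'rV[R]_n.+1 :=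
  row_mx (const_mx p.1 : 'rV_1) p.2.

Lemma rV_cons0 n (p : measurableTypeR R * 'rV[R]_n) : rV_cons p ord0 ord0 = p.1.
Proof. by rewrite mxE; case: splitP => // j; rewrite ?mxE. Qed.

Lemma rV_consS n (p : measurableTypeR R * 'rV[R]_n) (i : 'I_n) :
  rV_cons p ord0 (lift ord0 i) = p.2 ord0 i.
Proof.
rewrite mxE; case: splitP => [[[|//] ?]//|j /eqP].
by rewrite eqSS => /eqP ij; congr (p.2 _ _); exact: val_inj.
Qed.

Lemma measurable_rV_cons n : measurable_fun setT (@rV_cons n).
Proof.
apply: measurable_fun_rV => i; case: (unliftP ord0 i) => [j ->|->].
  under eq_fun do rewrite rV_consS.
  by apply: (measurableT_comp (measurable_coor j)); exact: measurable_snd.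
under eq_fun do rewrite rV_cons0.
exact: measurable_fst.
Qed.

Definition rV_uncons n (v : 'rV[R]_n.+1) : measurableTypeR R * 'rV[R]_n :=
  (v ord0 ord0, \row_i v ord0 (lift ord0 i)).

Lemma rV_consK n : cancel (@rV_cons n) (@rV_uncons n).
Proof.
move=> p; rewrite /rV_uncons rV_cons0 [RHS]surjective_pairing; congr pair.
by apply/rowP => i; rewrite mxE rV_consS.
Qed.

Lemma measurable_rV_uncons n : measurable_fun setT (@rV_uncons n).
Proof.
apply: measurable_fun_pair; first exact: (measurable_coor ord0).
apply: measurable_fun_rV => i /=.
under eq_fun do rewrite mxE.
exact: measurable_coor.
Qed.

End measurable_rV_theory.

Section lebesgue_rV.
Context {R : realType}.
Local Open Scope ereal_scope.

Section step.
Context (n : nat) (m : {sigma_finite_measure set 'rV[R]_n -> \bar R}).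

Definition lebesgue_rV_step : set 'rV[R]_n.+1 -> \bar R :=
  pushforward (@lebesgue_measure R \x m) (@rV_cons R n).

Let lebesgue_rV_step0 : lebesgue_rV_step set0 = 0.
Proof. by rewrite /lebesgue_rV_step /pushforward preimage_set0 measure0. Qed.

Let lebesgue_rV_step_ge0 A : 0 <= lebesgue_rV_step A.
Proof. by rewrite /lebesgue_rV_step /pushforward; apply: measure_ge0. Qed.

Let lebesgue_rV_step_sigma_additive : semi_sigma_additive lebesgue_rV_step.
Proof.
exact: (@measure_semi_sigma_additive _ _ _
  (measure_function_pushforward__canonical__measure_function_Measure
     (@lebesgue_measure R \x m) (@measurable_rV_cons R n))).
Qed.

HB.instance Definition _ := isMeasure.Build _ _ _ lebesgue_rV_step
  lebesgue_rV_step0 lebesgue_rV_step_ge0 lebesgue_rV_step_sigma_additive.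

Let lebesgue_rV_step_sigma_finite : sigma_finite setT lebesgue_rV_step.
Proof.
have /sigma_finiteP[F [FT ndF Foo]] := sigma_finiteT (@lebesgue_measure R).
have /sigma_finiteP[G [GT ndG Goo]] := sigma_finiteT m.
exists (fun k => @rV_uncons R n @^-1` (F k `*` G k)).
  apply/esym; rewrite -subTset => v _.
  have [k _ Fk] : (\bigcup_i F i) (v ord0 ord0) by rewrite -FT.
  have [l _ Gl] : (\bigcup_i G i) (rV_uncons v).2 by rewrite -GT.
  exists (maxn k l) => //; split => /=.
    by move: Fk; exact/subsetPset/ndF/leq_maxl.
  by move: Gl; exact/subsetPset/ndG/leq_maxr.
move=> k; have [mF Fk] := Foo k; have [mG Gk] := Goo k; split.
  rewrite -[X in measurable X]setTI; apply: measurable_rV_uncons => //.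
  exact: measurableX.
rewrite /lebesgue_rV_step /pushforward -comp_preimage.
rewrite (_ : _ \o _ = idfun); last by apply/funext => x; exact: rV_consK.
by rewrite preimage_id product_measure1E// lte_mul_pinfty// ge0_fin_numE.
Qed.

HB.instance Definition _ := Measure_isSigmaFinite.Build _ _ _ lebesgue_rV_step
  lebesgue_rV_step_sigma_finite.

End step.

(* Lebesgue measure on R^n, by iterated products; on R^0 it is the unit mass. *)
Fixpoint lebesgue_rV (n : nat) : {sigma_finite_measure set 'rV[R]_n -> \bar R} :=
  match n with
  | 0 => dirac (0%R : 'rV[R]_0)
  | n'.+1 => lebesgue_rV_step (lebesgue_rV n')
  end.

Definition cube n (a b : R) : set 'rV[R]_n :=
  [set v | forall i, v ord0 i \in `[a, b]%R].
Arguments cube n a b _ : clear implicits.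

Lemma measurable_cube n (a b : R) : measurable (cube n a b).
Proof.
rewrite (_ : cube n a b = \bigcap_(i in [set: 'I_n])
   (fun v : 'rV[R]_n => v ord0 i : measurableTypeR R) @^-1` `[a, b]); last first.
  apply/seteqP; split => [v /= h i _ /=|v h i].
    exact: h.
  exact: h i I.
apply: fin_bigcap_measurable => // i _.
by rewrite -[X in measurable X]setTI; exact: measurable_coor.
Qed.

Lemma lebesgue_rV_cube n (a b : R) : (a <= b)%R ->
  lebesgue_rV n (cube n a b) = ((b - a) ^+ n)%:E.
Proof.
move=> ab; have LI : lebesgue_measure
    (`[a, b]%classic : set (measurableTypeR R)) = (b - a)%:E.
  rewrite [LHS]lebesgue_measure_itv/= lte_fin; case: ltP => // ba.
  by have -> : a = b by [apply/eqP; rewrite eq_le ab ba]; rewrite subrr.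
elim: n => [|n IHn].
  by rewrite [LHS]diracE mem_set ?expr0//= => -[].
rewrite -[LHS]/((@lebesgue_measure R \x lebesgue_rV n) (@rV_cons R n @^-1` _)).
rewrite (_ : @rV_cons R n @^-1` _ = (`[a, b]%classic : set (measurableTypeR R))
    `*` cube n a b).
  rewrite product_measure1E//; last exact: measurable_cube.
  rewrite exprS EFinM; congr (_ * _); [exact: LI|exact: IHn].
apply/seteqP; split => [[x v] /= h|[x v] /= [hx hv] i]; last first.
  by case: (unliftP ord0 i) => [j ->|->]; rewrite ?rV_cons0 ?rV_consS.
split; first by have := h ord0; rewrite rV_cons0.
by move=> i; have := h (lift ord0 i); rewrite rV_consS.
Qed.

End lebesgue_rV.
Arguments cube {R} n a b _.

Section sphere.
Context {R : realType}.

Definition dot n (x y : 'rV[R]_n) : R := \sum_(i < n) x ord0 i * y ord0 i.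

Definition sphere n : set 'rV[R]_n := [set x | dot x x = 1].

Definition unit_ball n : set 'rV[R]_n := [set x | dot x x <= 1].

Definition cone n (A : set 'rV[R]_n) : set 'rV[R]_n :=
  [set t *: x | t in `]0, 1]%classic & x in A `&` @sphere n].

Lemma dotZ n (t : R) (x : 'rV[R]_n) : dot (t *: x) (t *: x) = t ^+ 2 * dot x x.
Proof. by rewrite /dot mulr_sumr; apply: eq_bigr => i _; rewrite !mxE; ring. Qed.

Lemma dot_ge0 n (x : 'rV[R]_n) : 0 <= dot x x.
Proof. by apply: sumr_ge0 => i _; rewrite -expr2 sqr_ge0. Qed.

Lemma measurable_dot n : measurable_fun setT (fun x : 'rV[R]_n => dot x x).
Proof.
apply: measurable_sum => i; apply: measurable_funM; exact: measurable_coor.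
Qed.

Lemma measurable_unit_ball n : measurable (@unit_ball n).
Proof.
rewrite -[X in measurable X]setTI.
rewrite (_ : @unit_ball n = (fun x => dot x x) @^-1` `]-oo, 1]%classic).
  exact: measurable_dot.
by apply/seteqP; split => x /=; rewrite in_itv.
Qed.

Let proj n (x : 'rV[R]_n) : 'rV[R]_n := dot x x `^ (- 2^-1) *: x.

Let measurable_proj n : measurable_fun setT (@proj n).
Proof.
apply: measurable_fun_rV => i; rewrite /proj.
under eq_fun do rewrite mxE.
apply: measurable_funM; last exact: measurable_coor.
by apply: (measurableT_comp (measurable_powR _)); exact: measurable_dot.
Qed.

Let pball n : set 'rV[R]_n := @unit_ball n `\` [set x | dot x x = 0].

Let measurable_pball n : measurable (@pball n).
Proof.
apply: measurableD; first exact: measurable_unit_ball.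
rewrite -[X in measurable X]setTI.
exact: (@measurable_dot n _ [set 0]).
Qed.

Let coneE n (A : set 'rV[R]_n) : cone A = @pball n `&` @proj n @^-1` A.
Proof.
apply/seteqP; split => [v|v [[v1 /= v0] Av]].
  case=> t; rewrite /= in_itv/= => /andP[t0 t1] [x [Ax sx] <-].
  rewrite /pball /unit_ball /proj /= dotZ sx mulr1; split; first split.
  - by rewrite expr_le1// ltW.
  - by apply/eqP; rewrite expf_neq0// gt_eqF.
  - rewrite powRN powR12_sqrt ?sqr_ge0// sqrtr_sqr gtr0_norm// scalerA.
    by rewrite mulVf ?scale1r// gt_eqF.
have dv0 : 0 < dot v v by rewrite lt_neqAle dot_ge0 eq_sym andbT; apply/eqP.
exists (Num.sqrt (dot v v)).
  by rewrite /= in_itv/= sqrtr_gt0 dv0 -sqrtr1 ler_wsqrtr.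
exists (proj v).
  split=> //; rewrite /sphere /= /proj dotZ powRN powR12_sqrt ?dot_ge0//.
  by rewrite exprVn sqr_sqrtr ?dot_ge0// mulVf// gt_eqF.
rewrite /proj powRN powR12_sqrt ?dot_ge0// scalerA mulfV ?scale1r//.
by rewrite gt_eqF// sqrtr_gt0.
Qed.

Local Open Scope ereal_scope.

(* Normalised surface area: for Borel A in the sphere of R^n, the surface area
   of A is n times the volume of the cone {t x | 0 < t <= 1, x in A}; the factor
   n cancels in the normalisation.  It is a measure on the ambient space
   which ignores the part of A outside the sphere. *)
Definition sphere_measure n (A : set 'rV[R]_n) : \bar R :=
  lebesgue_rV n (cone A) * ((fine (lebesgue_rV n (@unit_ball n)))^-1)%:E.

Let sub_cube n (A : set 'rV[R]_n) (a b : R) : (a <= b)%R -> measurable A ->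
  cube n a b `<=` A ->
  ((b - a) ^+ n)%:E <= lebesgue_rV n A.
Proof.
move=> ab mA sA; rewrite -lebesgue_rV_cube//; apply: le_measure => //.
  by rewrite inE; exact: measurable_cube.
by rewrite inE.
Qed.

Lemma unit_ball_gt0 n : 0 < lebesgue_rV n (@unit_ball n).
Proof.
apply: (@lt_le_trans _ _ ((((n.+1%:R^-1 : R) - 0) ^+ n)%:E)).
  by rewrite lte_fin subr0 exprn_gt0// invr_gt0.
apply: sub_cube => //; first exact: measurable_unit_ball.
move=> v /= hv; rewrite /unit_ball /= /dot.
apply: (@le_trans _ _ (\sum_(i < n) (n.+1%:R^-1 : R))%R).
  apply: ler_sum => i _; have := hv i; rewrite in_itv/= => /andP[v0 v1].
  apply: (le_trans _ v1); rewrite ler_piMl// (le_trans v1)//.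
  by rewrite invf_le1// ler1n.
rewrite sumr_const card_ord -[leLHS]mulr_natl ler_pdivrMr// mul1r ler_nat.
exact: leqnSn.
Qed.

Lemma unit_ball_lty n : lebesgue_rV n (@unit_ball n) < +oo.
Proof.
apply: (@le_lt_trans _ _ (((1 - (-1) : R) ^+ n)%:E)); last exact: ltry.
rewrite -lebesgue_rV_cube; last by lra.
apply: le_measure; rewrite ?inE; first exact: measurable_unit_ball.
  exact: measurable_cube.
move=> v /= v1 i; rewrite in_itv/= -ler_norml.
rewrite -(@expr_le1 _ 2)// real_normK ?num_real//; apply: le_trans v1.
rewrite /dot (bigD1 i)//= -expr2 lerDl.
by apply: sumr_ge0 => j _; rewrite -expr2 sqr_ge0.
Qed.

Lemma unit_ball_fin_num n : lebesgue_rV n (@unit_ball n) \is a fin_num.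
Proof. by rewrite ge0_fin_numE// unit_ball_lty. Qed.

Let ball_inv_ge0 n : (0 <= (fine (lebesgue_rV n (@unit_ball n)))^-1 :> R)%R.
Proof. by rewrite invr_ge0 fine_ge0. Qed.

Let sphere_measureE n : @sphere_measure n =
  mscale (NngNum (@ball_inv_ge0 n))
   (measure_function_pushforward__canonical__measure_function_Measure
     (mrestr (lebesgue_rV n) (@measurable_pball n)) (@measurable_proj n)).
Proof.
apply/funext => A.
by rewrite /sphere_measure /mscale /= /pushforward /mrestr coneE setIC muleC.
Qed.

Let sphere_measure0 n : @sphere_measure n set0 = 0.
Proof. by rewrite sphere_measureE measure0. Qed.

Let sphere_measure_ge0 n A : 0 <= @sphere_measure n A.
Proof. by rewrite sphere_measureE measure_ge0. Qed.

Let sphere_measure_sigma_additive n : semi_sigma_additive (@sphere_measure n).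
Proof. by rewrite sphere_measureE; exact: measure_semi_sigma_additive. Qed.

HB.instance Definition _ n := isMeasure.Build _ _ _ (@sphere_measure n)
  (@sphere_measure0 n) (@sphere_measure_ge0 n) (@sphere_measure_sigma_additive n).

Let sphere_measureT n : @sphere_measure n.+1 setT = 1.
Proof.
rewrite /sphere_measure coneE preimage_setT setIT.
rewrite (_ : lebesgue_rV n.+1 (@pball n.+1) = lebesgue_rV n.+1 (@unit_ball n.+1)).
  rewrite -[X in X * _](fineK (unit_ball_fin_num _)) -EFinM mulfV// gt_eqF//.
  by rewrite fine_gt0// unit_ball_gt0 unit_ball_lty.
pose Z : set 'rV[R]_n.+1 := cube n.+1 0 0.
have mZ : measurable Z by exact: measurable_cube.
have Z0 : lebesgue_rV n.+1 Z = 0 by rewrite lebesgue_rV_cube// subrr expr0n.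
apply/eqP; rewrite eq_le; apply/andP; split.
  apply: le_measure; rewrite ?inE; first exact: measurable_pball.
    exact: measurable_unit_ball.
  by move=> x [].
rewrite -[leRHS]adde0 -Z0.
apply: le_trans (measureU2 _ (@measurable_pball _) mZ).
apply: le_measure; rewrite ?inE; first exact: measurable_unit_ball.
  by apply: measurableU => //; exact: measurable_pball.
move=> x x1; have [x0|x0] := pselect (dot x x = 0%R); last by left.
right => i; rewrite in_itv/=; suff -> : x ord0 i = 0%R by rewrite lexx.
apply/eqP; move/eqP: x0; rewrite /dot psumr_eq0; last first.
  by move=> j _; rewrite -expr2 sqr_ge0.
by move/allP => /(_ i); rewrite mem_index_enum mulf_eq0 orbb; exact.
Qed.

HB.instance Definition _ n := Measure_isProbability.Build _ _ _
  (@sphere_measure n.+1) (@sphere_measureT n).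

Lemma sphere_measure_sphere n : @sphere_measure n.+1 (@sphere n.+1) = 1.
Proof.
rewrite -(sphere_measureT n) /sphere_measure; congr (lebesgue_rV _ _ * _).
apply/seteqP; split => _ [t t01 [x [Ax sx] <-]]; exists t => //; exists x => //.
Qed.

End sphere.

Section hyperuniformity.
Context {R : realType}.
Implicit Types (d : nat) (phi : R).

Definition cap d (x : 'rV[R]_d.+1) phi : set 'rV[R]_d.+1 :=
  [set y | sphere y /\ cos phi < dot x y].

(* The measure of a cap does not depend on its centre; we take (1, 0, ..., 0). *)
Definition cap_measure d phi : R :=
  fine (sphere_measure (cap (delta_mx ord0 ord0 : 'rV[R]_d.+1) phi)).

Definition npoints d (X : {fset 'rV[R]_d.+1}) (C : set 'rV[R]_d.+1) : nat :=
  #|` [fset y in X | y \in C]|%fset.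

Definition number_variance d (X : {fset 'rV[R]_d.+1}) phi : R :=
  \int[@sphere_measure R d.+1]_(x in @sphere R d.+1)
    ((npoints X (cap x phi))%:R - #|` X|%fset%:R * cap_measure d phi) ^+ 2.

Definition hyperuniform_small_caps d (X : nat -> {fset 'rV[R]_d.+1}) : Prop :=
  forall phi : nat -> R, (forall N, 0 <= phi N <= pi) ->
    phi @ \oo --> (0 : R) ->
    N%:R * cap_measure d (phi N) @[N --> \oo] --> +oo ->
    (fun N => number_variance (X N) (phi N)) =o_\oo
      (fun N => N%:R * cap_measure d (phi N)).

Definition uniformly_distributed d (X : nat -> {fset 'rV[R]_d.+1}) : Prop :=
  forall (x : 'rV[R]_d.+1) phi, sphere x -> 0 <= phi <= pi ->
    N%:R^-1 * (npoints (X N) (cap x phi))%:R @[N --> \oo]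
      --> fine (sphere_measure (cap x phi)).

End hyperuniformity.

(* Main.v *)
Require Import Defs.
From HB Require Import structures.
From mathcomp Require Import all_boot all_order all_algebra finmap.
From mathcomp Require Import all_classical all_reals all_analysis.
From mathcomp Require Import measurable_realfun ring lra.
Set Implicit Arguments.
Unset Strict Implicit.
Unset Printing Implicit Defensive.
Import Order.TTheory GRing.Theory Num.Theory.
Import numFieldNormedType.Exports.

Local Open Scope classical_set_scope.
Local Open Scope ring_scope.

(* Small number variance at a scale phi_N -> 0 with N sigma(C(., phi_N)) -> oo
   says that the normalised counting functions
   x |-> #(X_N cap C(x, phi_N)) / (N sigma(C(., phi_N))) tend to 1 in mean.
   Integrating them over a cap A exchanges the roles of centres and points and
   gives 1/N times the sum over p in X_N of
   sigma(C(p, phi_N) cap A) / sigma(C(p, phi_N)); each term is 1 if p lies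
   well inside A and 0 if p lies well outside A.  Hence the proportion of X_N
   in a cap is squeezed between the measures of a slightly smaller and a slightly
   larger cap, which are close because spheres <x, y> = c are null sets.
   That sigma(C(p, phi)) does not depend on p follows from the invariance of
   Lebesgue measure under Householder reflections. *)

(** * Invariance of Lebesgue measure *)

Section reflect.
Context {R : realType}.

Lemma measurable_preimageT d1 d2 (T1 : measurableType d1)
    (T2 : measurableType d2) (f : T1 -> T2) (A : set T2) :
  measurable_fun setT f -> measurable A -> measurable (f @^-1` A).
Proof. by move=> mf mA; rewrite -[X in measurable X]setTI; exact: mf. Qed.

(** Tonelli for indicators: the two iterated integrals agree on rectangles, which determine the
    product measure. Sections can thus be taken in either variable. *)
Lemma product_measure12 d1 d2 (T1 : measurableType d1) (T2 : measurableType d2)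
    (m1 : {sigma_finite_measure set T1 -> \bar R})
    (m2 : {sigma_finite_measure set T2 -> \bar R}) (A : set (T1 * T2)) :
  measurable A -> (m1 \x m2)%E A = (m1 \x^ m2)%E A.
Proof.
by move=> mA; apply: product_measure_unique => //= ? ? ? ?; exact: product_measure2E.
Qed.

Lemma measurable_subl (c : R) :
  measurable_fun setT (fun t : measurableTypeR R => c - t : measurableTypeR R).
Proof. by apply: measurable_funB. Qed.

(** The reflection turns a half-open interval into one of the same length with the other end closed,
    and intervals determine the measure. *)
Lemma lebesgue_measure_reflect (c : R) (A : set (measurableTypeR R)) :
  measurable A ->
  lebesgue_measure ((fun t : measurableTypeR R => c - t) @^-1` A) =
  lebesgue_measure A.
Proof.
move=> mA; have mf := measurable_subl c.
pose m := measure_function_pushforward__canonical__measure_function_Measure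
  (@lebesgue_measure R) mf.
rewrite [RHS](@lebesgue_measure_unique R m)//.
move=> X [[a b] /= ab <-]; rewrite /m /pushforward/=.
rewrite (_ : _ @^-1` _ = `[c - b, c - a[%classic); last first.
  apply/seteqP; split=> t /=; rewrite !in_itv/= => /andP[? ?];
    by apply/andP; split; lra.
rewrite !lebesgue_measure_itv/= !lte_fin.
rewrite (_ : (c - b < c - a) = (a < b)); last by apply/idP/idP; lra.
by case: ifPn => // _; congr EFin; lra.
Qed.

Lemma measurable_rV_coor d (T : measurableType d) n (f : T -> 'rV[R]_n) i :
  measurable_fun setT f ->
  measurable_fun setT (fun x => f x ord0 i : measurableTypeR R).
Proof. by move=> mf; apply: (measurableT_comp (measurable_coor i)). Qed.

Lemma measurable_rVB d (T : measurableType d) n (f g : T -> 'rV[R]_n) :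
  measurable_fun setT f -> measurable_fun setT g ->
  measurable_fun setT (fun x => f x - g x).
Proof.
move=> mf mg; apply: measurable_fun_rV => i.
under eq_fun do rewrite !mxE.
by apply: measurable_funB; exact: measurable_rV_coor.
Qed.

(** Induction on the dimension: once the first coordinate is split off, the reflection acts on each
    factor separately, and rectangles determine the product measure. *)
Lemma lebesgue_rV_reflect n (c : 'rV[R]_n) (A : set 'rV[R]_n) :
  measurable A ->
  lebesgue_rV n ((fun v => c - v) @^-1` A) = lebesgue_rV n A.
Proof.
elim: n c A => [|n IHn] c A mA.
  congr (lebesgue_rV 0 _); apply/seteqP.
  by split=> v /=; congr A; apply/rowP => -[].
have mc : measurable_fun setT (fun v : 'rV[R]_n => (rV_uncons c).2 - v).
  by apply: measurable_rVB.
pose F (p : measurableTypeR R * 'rV[R]_n) : measurableTypeR R * 'rV[R]_n :=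
  (c ord0 ord0 - p.1, (rV_uncons c).2 - p.2).
have mF : measurable_fun setT F.
  apply: measurable_fun_pair.
    exact: (measurableT_comp (measurable_subl _) measurable_fst).
  exact: (measurableT_comp mc measurable_snd).
rewrite -[LHS]/((@lebesgue_measure R \x lebesgue_rV n)%E (@rV_cons R n @^-1` _)).
rewrite -[RHS]/((@lebesgue_measure R \x lebesgue_rV n)%E (@rV_cons R n @^-1` A)).
rewrite -comp_preimage.
have -> : (fun v => c - v) \o rV_cons (n:=n) = rV_cons (n:=n) \o F.
  apply/funext => p; apply/rowP => i; rewrite /= mxE [X in _ + X]mxE.
  by case: (unliftP ord0 i) => [j ->|->]; rewrite ?rV_consS ?rV_cons0//= !mxE.
have mA' : measurable (@rV_cons R n @^-1` A).
  exact: (measurable_preimageT (@measurable_rV_cons R n) mA).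
pose m := measure_function_pushforward__canonical__measure_function_Measure
  (@lebesgue_measure R \x lebesgue_rV n)%E mF.
rewrite comp_preimage -[LHS]/(m (rV_cons (n:=n) @^-1` A)).
rewrite [RHS](@product_measure_unique _ _ _ _ _ _ _ m)// => B C mB mC.
rewrite /m /= /pushforward.
have -> : F @^-1` (B `*` C) = ((fun t : measurableTypeR R => c ord0 ord0 - t) @^-1` B) `*`
    ((fun v : 'rV[R]_n => (rV_uncons c).2 - v) @^-1` C) by [].
rewrite product_measure1E ?IHn//.
- by congr (_ * _)%E; exact: lebesgue_measure_reflect.
- exact: measurable_preimageT (measurable_subl _) mB.
- exact: measurable_preimageT mc mC.
Qed.

(** A translation is the composite of the two reflections [v |-> c - v] and [v |-> 0 - v]. *)
Lemma lebesgue_rV_translate n (c : 'rV[R]_n) (A : set 'rV[R]_n) :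
  measurable A ->
  lebesgue_rV n ((fun v => v - c) @^-1` A) = lebesgue_rV n A.
Proof.
move=> mA; have mN : measurable ((fun v : 'rV[R]_n => 0 - v) @^-1` A).
  by apply: measurable_preimageT mA; exact: measurable_rVB.
rewrite -[RHS](lebesgue_rV_reflect 0)// -[RHS](lebesgue_rV_reflect c)//.
by congr (lebesgue_rV n _); apply/seteqP; split=> v /=; rewrite sub0r opprB.
Qed.

(** * Additive isometric involutions *)

Section isometry.
Context n (T : 'rV[R]_n -> 'rV[R]_n).
Hypotheses (T_meas : measurable_fun setT T) (TB : {morph T : u v / u - v})
  (TK : involutive T).

Let E (A B : set 'rV[R]_n) : set ('rV[R]_n * 'rV[R]_n) :=
  [set z | A z.1 /\ B (T z.2 - z.1)].

Let mE A B : measurable A -> measurable B -> measurable (E A B).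
Proof.
move=> mA mB; apply: (@measurableI _ _ (fst @^-1` A)
    ((fun z : 'rV[R]_n * 'rV[R]_n => T z.2 - z.1) @^-1` B)).
  exact: measurable_preimageT measurable_fst mA.
apply: measurable_preimageT mB; apply: measurable_rVB => //.
exact: (measurableT_comp T_meas measurable_snd).
Qed.

Let mT A : measurable A -> measurable (T @^-1` A).
Proof. exact: measurable_preimageT. Qed.

Local Open Scope ereal_scope.
Let lam := lebesgue_rV (R := R) n.

(** Since [T] is an additive involution, [T y - x = T (y - T x)]; so the section over each [x] in
    [A] is the translate of [T^-1 B] by [T x]. *)
Let prodE A B : measurable A -> measurable B ->
  (lam \x lam) (E A B) = lam A * lam (T @^-1` B).
Proof.
move=> mA mB; rewrite /product_measure1.
rewrite (eq_integral (fun x => (\1_A x)%:E * lam (T @^-1` B))).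
  rewrite ge0_integralZr ?integral_indic ?setIT//; apply/measurable_EFinP.
  exact: measurable_indic.
move=> x _ /=; rewrite indicE; case: (boolP (x \in A)) => [|/negP] Ax.
  rewrite mul1e -[RHS](lebesgue_rV_translate (T x)); last exact: mT.
  congr (lam _); rewrite xsectionE; apply/seteqP; split => y /=; rewrite TB TK.
    by case.
  by split => //; exact: set_mem.
rewrite mul0e (_ : xsection _ _ = set0) ?measure0// xsectionE -subset0.
by move=> y [Ax' _]; apply: Ax; exact: mem_set.
Qed.

(** For fixed [y], the reflection [x |-> T y - x] exchanges the two conditions on [x] that define
    [E A B] and [E B A]. *)
Let prodC A B : measurable A -> measurable B ->
  (lam \x lam) (E A B) = (lam \x lam) (E B A).
Proof.
move=> mA mB; rewrite !product_measure12; [|exact: mE|exact: mE].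
rewrite /product_measure2; apply: eq_integral => y _ /=.
rewrite -(lebesgue_rV_reflect (T y)); last by apply: measurable_ysection; exact: mE.
congr (lam _); rewrite !ysectionE /E; apply/seteqP; split => x /=; rewrite subKr; tauto.
Qed.

(* Commuting the two integrals of 1_A(x) 1_B(T y - x) gives
   |A| |T^-1 B| = |B| |T^-1 A|; B is then taken T-invariant. *)
Lemma lebesgue_rV_isometry (A : set 'rV[R]_n) :
  (forall v, dot (T v) (T v) = dot v v) -> measurable A ->
  lebesgue_rV n (T @^-1` A) = lebesgue_rV n A.
Proof.
move=> Tdot mA; have mB := @measurable_unit_ball R n.
have TUB : T @^-1` @unit_ball R n = @unit_ball R n.
  by apply/seteqP; split => v; rewrite /unit_ball /= Tdot.
have := prodC mA mB; rewrite !prodE// TUB muleC.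
have B0 : 0 < lam (@unit_ball R n) by exact: unit_ball_gt0.
move=> e; apply/eqP; rewrite eq_le.
by rewrite -(lee_pmul2l (unit_ball_fin_num n) B0) e lexx/=
  -(lee_pmul2l (unit_ball_fin_num n) B0) e lexx.
Qed.

End isometry.

End reflect.

(** * Householder reflections and spherical measure *)

Section dot.
Context {R : realType} {n : nat}.
Implicit Types u v w x y : 'rV[R]_n.

Lemma dotC u v : dot u v = dot v u.
Proof. by apply: eq_bigr => i _; rewrite mulrC. Qed.

Lemma dotDl u v w : dot (u + v) w = dot u w + dot v w.
Proof. by rewrite -big_split; apply: eq_bigr => i _; rewrite mxE mulrDl. Qed.

Lemma dotZl (a : R) u v : dot (a *: u) v = a * dot u v.
Proof. by rewrite mulr_sumr; apply: eq_bigr => i _; rewrite mxE mulrA. Qed.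

Lemma dotBl u v w : dot (u - v) w = dot u w - dot v w.
Proof. by rewrite dotDl -scaleN1r dotZl mulN1r. Qed.

Lemma dotZr (a : R) u v : dot u (a *: v) = a * dot u v.
Proof. by rewrite dotC dotZl dotC. Qed.

Lemma dotBr u v w : dot u (v - w) = dot u v - dot u w.
Proof. by rewrite !(dotC u) dotBl. Qed.

Lemma dot_eq0 u : dot u u = 0 -> u = 0.
Proof.
move/eqP; rewrite /dot psumr_eq0 => [|i _]; last by rewrite -expr2 sqr_ge0.
move=> /allP u0; apply/rowP => i; rewrite mxE; apply/eqP.
by have := u0 i; rewrite mem_index_enum mulf_eq0 orbb; exact.
Qed.

(** The difference of the two sides is the squared length of the component of [v] orthogonal to
    [x]. *)
Lemma cauchy_schwarz_unit x v : sphere x -> dot x v ^+ 2 <= dot v v.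
Proof.
move=> x1; have := dot_ge0 (v - dot x v *: x).
rewrite !(dotBl, dotBr, dotZl, dotZr) (dotC v x) x1; nra.
Qed.

(** Cauchy-Schwarz applied to [p - y], with [|p - y|^2 = 2 (1 - <p, y>)]: nearby points have nearby
    heights over [x]. *)
Lemma dot_sphere_dist x p y : sphere x -> sphere p -> sphere y ->
  (dot x p - dot x y) ^+ 2 <= 2 * (1 - dot p y).
Proof.
move=> x1 p1 y1; rewrite -dotBr (le_trans (cauchy_schwarz_unit _ x1))//.
rewrite dotBl !dotBr p1 y1 (dotC y p); lra.
Qed.

Lemma measurable_dotl x :
  measurable_fun setT (fun y => dot x y : measurableTypeR R).
Proof.
apply: measurable_sum => i; apply: measurable_funM => //.
exact: measurable_coor.
Qed.

Lemma measurable_sphere : measurable (@sphere R n).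
Proof.
rewrite (_ : @sphere R n = (fun y => dot y y : measurableTypeR R) @^-1` [set 1]).
  by apply: measurable_preimageT => //; exact: measurable_dot.
by apply/seteqP; split.
Qed.

(** Reflection in the hyperplane orthogonal to [u]. For [u = 0] the division by zero yields 0, and
    the map is the identity. *)
Definition householder u v : 'rV[R]_n := v - (2 * dot u v / dot u u) *: u.

Lemma householderB u : {morph householder u : v w / v - w}.
Proof.
move=> v w; rewrite /householder dotBr.
by apply/rowP => i; rewrite !mxE; ring.
Qed.

Lemma householder_dot u v w : dot (householder u v) (householder u w) = dot v w.
Proof.
rewrite /householder !(dotBl, dotBr, dotZl, dotZr) (dotC v u).
have [->|u0] := eqVneq (dot u u) 0; first by rewrite invr0; ring.
by field.
Qed.

Lemma householderK u : involutive (householder u).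
Proof.
move=> v; rewrite /householder dotBr dotZr -addrA -opprD -scalerDl.
have [/dot_eq0 ->|u0] := eqVneq (dot u u) 0; first by rewrite scaler0 subr0.
by rewrite [X in X *: _](_ : _ = 0) ?scale0r ?subr0//; field.
Qed.

Lemma householder_swap x y : sphere x -> sphere y -> householder (x - y) x = y.
Proof.
move=> x1 y1; rewrite /householder.
have [/dot_eq0 /subr0_eq ->|u0] := eqVneq (dot (x - y) (x - y)) 0.
  by rewrite subrr scaler0 subr0.
(* Because [x] and [y] have equal length, the coefficient of [x - y] in the reflection is exactly
   1. *)
have e : 2 * dot (x - y) x = dot (x - y) (x - y).
  by rewrite !(dotBl, dotBr) x1 y1 (dotC y x); ring.
by rewrite e divff// scale1r subKr.
Qed.

Lemma measurable_householder u : measurable_fun setT (householder u).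
Proof.
apply: measurable_rVB => //; apply: measurable_fun_rV => i.
under eq_fun do rewrite mxE.
apply: measurable_funM => //; apply: measurable_funM => //.
by apply: measurable_funM => //; exact: measurable_dotl.
Qed.

Lemma householder_sphere u v : sphere (householder u v) = sphere v.
Proof. by rewrite /sphere /= householder_dot. Qed.

(** The radius and the direction of a point of the cone are its norm and its normalisation, so both
    existentials can be eliminated. *)
Lemma coneP (A : set 'rV[R]_n) v : cone A v <->
  [/\ 0 < dot v v, dot v v <= 1 & A ((Num.sqrt (dot v v))^-1 *: v)].
Proof.
split=> [[t] /=|[v0 v1 Av]].
  rewrite in_itv/= => /andP[t0 t1] [x [Ax sx] <-].
  rewrite dotZ sx mulr1 sqrtr_sqr gtr0_norm// scalerA mulVf ?gt_eqF//.
  by rewrite scale1r exprn_gt0// expr_le1// ltW.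
have s0 : 0 < Num.sqrt (dot v v) by rewrite sqrtr_gt0.
exists (Num.sqrt (dot v v)).
  by rewrite /= in_itv/= s0 -sqrtr1 ler_wsqrtr.
exists ((Num.sqrt (dot v v))^-1 *: v).
  split=> //; rewrite /sphere /= dotZ exprVn sqr_sqrtr ?dot_ge0// mulVf//.
  by rewrite gt_eqF.
by rewrite scalerA mulfV ?scale1r// gt_eqF.
Qed.

Lemma measurable_cone (A : set 'rV[R]_n) : measurable A -> measurable (cone A).
Proof.
move=> mA; have md := @measurable_dot R n.
rewrite (_ : cone A = (fun v => dot v v : measurableTypeR R) @^-1` `]0, 1] `&`
    (fun v => (Num.sqrt (dot v v))^-1 *: v) @^-1` A); last first.
  apply/seteqP; split=> v.
    by move/coneP => [v0 v1 Av]; split=> //=; rewrite in_itv/= v0.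
  by move=> []; rewrite /= in_itv/= => /andP[? ?] ?; apply/coneP.
apply: measurableI; first exact: measurable_preimageT.
apply: measurable_preimageT mA; apply: measurable_fun_rV => i.
under eq_fun do rewrite mxE.
apply: measurable_funM; last exact: measurable_coor.
rewrite (_ : (fun _ => _) = (fun v : 'rV[R]_n => dot v v `^ (- 2^-1))).
  exact: (measurableT_comp (measurable_powR _)).
by apply/funext => v; rewrite powRN powR12_sqrt ?dot_ge0.
Qed.

(** A reflection is linear and preserves norms, so the cone over a preimage is the preimage of the
    cone. *)
Lemma sphere_measure_householder u (A : set 'rV[R]_n) : measurable A ->
  sphere_measure (householder u @^-1` A) = sphere_measure A.
Proof.
move=> mA; rewrite /sphere_measure; congr (_ * _)%E.
rewrite -[RHS](@lebesgue_rV_isometry _ _ (householder u)).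
- congr (lebesgue_rV n _); apply/seteqP.
  have hZ a v : householder u (a *: v) = a *: householder u v.
    by rewrite /householder dotZr scalerBr scalerA; congr (_ - _ *: _); ring.
  by split=> v /=; rewrite !coneP householder_dot -hZ.
- exact: measurable_householder.
- exact: householderB.
- exact: householderK.
- by move=> v; rewrite householder_dot.
- exact: measurable_cone.
Qed.

(** Common form of caps ([P] a ray) and of sets of constant height over [x] ([P] a singleton). *)
Definition sphere_slice x (P : set R) : set 'rV[R]_n :=
  [set z | sphere z /\ P (dot x z)].

Lemma measurable_sphere_slice x (P : set R) :
  measurable (P : set (measurableTypeR R)) -> measurable (sphere_slice x P).
Proof.
move=> mP; apply: measurableI; first exact: measurable_sphere.
exact: measurable_preimageT (measurable_dotl x) mP.
Qed.

(** The reflection along [x - y] exchanges [x] and [y], hence the two slices. *)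
Lemma sphere_measure_slice x y (P : set R) :
  measurable (P : set (measurableTypeR R)) -> sphere x -> sphere y ->
  sphere_measure (sphere_slice x P) = sphere_measure (sphere_slice y P).
Proof.
move=> mP x1 y1; rewrite -(sphere_measure_householder (x - y)).
  congr sphere_measure; apply/seteqP.
  by split=> z; rewrite /sphere_slice /= householder_sphere
    -(householder_dot (x - y) x) householderK householder_swap.
exact: measurable_sphere_slice.
Qed.

End dot.

(** * Measure of slices and caps *)

Section slices.
Context {R : realType}.

Lemma dot_delta0 n (v : 'rV[R]_n.+1) : dot (delta_mx ord0 ord0) v = v ord0 ord0.
Proof.
rewrite /dot (bigD1 ord0)//= mxE !eqxx mul1r big1 ?addr0// => i /negPf i0.
by rewrite mxE i0 andbF mul0r.
Qed.

Lemma sphere_delta0 n : @sphere R n.+1 (delta_mx ord0 ord0).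
Proof. by rewrite /sphere /= dot_delta0 mxE !eqxx. Qed.

Lemma dot_rV_cons n (t : R) (w : 'rV[R]_n) :
  dot (rV_cons (t, w)) (rV_cons (t, w)) = t ^+ 2 + dot w w.
Proof.
rewrite /dot big_ord_recl rV_cons0 -expr2; congr (_ + _).
by apply: eq_bigr => i _; rewrite rV_consS.
Qed.

Lemma lebesgue_measure_sqr_eq (k : R) : lebesgue_measure [set t : R | t ^+ 2 = k] = 0%E.
Proof.
apply: countable_lebesgue_measure0; apply: finite_set_countable.
apply: (@sub_finite_set _ _ [set Num.sqrt k; - Num.sqrt k]); last exact: finite_set2.
move=> t /= <-; rewrite sqrtr_sqr.
by have [t0|t0] := ger0P t; [left|right; rewrite opprK].
Qed.

(* Writing [v = (t, w)], the cone over the slice satisfies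
   [t ^+ 2 = c ^+ 2 * (t ^+ 2 + |w| ^+ 2)]: for [c ^+ 2 != 1] this leaves at
   most two [t] for each [w], and for [c ^+ 2 = 1] it forces [w = 0]. *)
Lemma sphere_measure_slice1 d (x : 'rV[R]_d.+1) (c : R) : (0 < d)%N ->
  sphere x -> sphere_measure (sphere_slice x [set c]) = 0%E.
Proof.
move=> d0 x1; rewrite (sphere_measure_slice _ x1 (sphere_delta0 d))//.
rewrite /sphere_measure; set C := cone _.
have mC : measurable C by apply: measurable_cone; exact: measurable_sphere_slice.
suff -> : lebesgue_rV d.+1 C = 0%E by rewrite mul0e.
have mC' := measurable_preimageT (@measurable_rV_cons R d) mC.
rewrite -[LHS]/((@lebesgue_measure R \x lebesgue_rV d)%E (@rV_cons R d @^-1` C)).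
have CP t w : C (rV_cons (t, w)) -> t ^+ 2 = c ^+ 2 * (t ^+ 2 + dot w w).
  move=> /coneP[]; rewrite dot_rV_cons => q0 _ [_] /=.
  rewrite dot_delta0 mxE rV_cons0/= => <-.
  by rewrite exprMn exprVn sqr_sqrtr ?ltW// mulrAC mulVf ?mul1r// gt_eqF.
have [c1|c1] := eqVneq (c ^+ 2) 1.
  have mZ : measurable (setT `*` cube d (0 : R) 0 :
      set (measurableTypeR R * 'rV[R]_d)).
    by apply: measurableX => //; exact: measurable_cube.
  have Z0 : (@lebesgue_measure R \x lebesgue_rV d)%E
      (setT `*` cube d (0 : R) 0) = 0%E.
    rewrite product_measure1E//; last exact: measurable_cube.
    rewrite [X in (_ * X)%E](_ : _ = 0%E) ?mule0//.
    (* Here [0 < d] enters: the origin of [R^d] has measure [0 ^+ d], which is 1 for [d = 0]. *)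
    by rewrite [LHS]lebesgue_rV_cube// subrr expr0n; case: d d0 {x x1 C mC mC' CP mZ}.
  apply: (subset_measure0 mC' mZ _ Z0).
  move=> [t w] /= /CP; rewrite c1 mul1r => tw; split => //= i.
  have /dot_eq0 -> : dot w w = 0 by lra.
  by rewrite mxE in_itv/= lexx.
rewrite product_measure12// /product_measure2; apply: integral0_eq => w _ /=.
(* The equation in [CP], solved for [t ^+ 2] with [w] fixed. *)
pose k := c ^+ 2 * dot w w / (1 - c ^+ 2).
have mk : measurable ([set t | t ^+ 2 = k] : set (measurableTypeR R)).
  have mX : measurable_fun setT (fun t : measurableTypeR R => t ^+ 2 : measurableTypeR R).
    exact: measurable_funX.
  exact: measurable_preimageT mX (measurable_set1 k).
apply: (subset_measure0 _ mk); [exact: measurable_ysection| |exact: lebesgue_measure_sqr_eq].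
rewrite ysectionE => t /= /CP tw; rewrite /k.
have c1' : 1 - c ^+ 2 != 0 by rewrite subr_eq0 eq_sym.
by apply: (mulIf c1'); rewrite divfK//; lra.
Qed.

(** * Caps with a variable threshold: continuity and positivity of their measure *)

Lemma measurable_ray (t : R) :
  measurable ([set r | t < r] : set (measurableTypeR R)).
Proof.
rewrite (_ : [set _ | _] = `]t, +oo[%classic)//.
by apply/seteqP; split=> r /=; rewrite in_itv/= andbT.
Qed.

(** A cap given by its height [t] instead of its angle; any real [t] is allowed, so thresholds can
    be shifted freely. [cap x phi] is convertible to [open_cap x (cos phi)]. *)
Definition open_cap d (x : 'rV[R]_d.+1) (t : R) := sphere_slice x [set r | t < r].

Lemma measurable_open_cap d (x : 'rV[R]_d.+1) t : measurable (open_cap x t).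
Proof. apply: measurable_sphere_slice; exact: measurable_ray. Qed.

Lemma sphere_measure_fin_num d (A : set 'rV[R]_d.+1) : measurable A ->
  sphere_measure A \is a fin_num.
Proof. by move=> mA; exact: (@fin_num_measure _ _ _ (@sphere_measure R d.+1)). Qed.

(** The caps of height [t - 1 / (k + 1)] decrease to the closed cap, which exceeds the open one by
    the null slice at height [t]. *)
Lemma open_cap_left_continuous d (x : 'rV[R]_d.+1) (t e : R) : (0 < d)%N ->
  sphere x -> 0 < e -> exists2 k : R, 0 < k &
  fine (sphere_measure (open_cap x (t - k))) <= fine (sphere_measure (open_cap x t)) + e.
Proof.
move=> d0 x1 e0; pose F k := open_cap x (t - k.+1%:R^-1).
have capF : \bigcap_k F k = open_cap x t `|` sphere_slice x [set t].
  apply/seteqP; split=> [y Fy|y [[sy yt]|[sy yt]] k _]; last 2 first.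
    by split=> //=; move: yt => /= yt; rewrite (le_lt_trans _ yt)// lerBlDr lerDl.
    by split=> //=; rewrite yt ltrBlDr ltrDl.
  have sy : sphere y by have [] := Fy 0%N I.
  have : t <= dot x y.
    apply/ler_addgt0Pl => a a0.
    have [k ka] : exists k, k.+1%:R^-1 < a :> R.
      have [k _ /(_ k (leqnn k))] := near_infty_natSinv_lt (PosNum a0).
      by exists k.
    have [_ /= ty] := Fy k I.
    by rewrite (le_trans _ (lerD (ltW ka) (ltW ty)))// addrC subrK.
  by rewrite le_eqVlt => /predU1P[->|]; [right|left].
have mF k : measurable (F k) by exact: measurable_open_cap.
have : sphere_measure (F k) @[k --> \oo] --> sphere_measure (\bigcap_k F k).
  apply: nonincreasing_cvg_mu => //.
  - by rewrite -ge0_fin_numE// sphere_measure_fin_num.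
  - exact: bigcap_measurable.
  - move=> k l kl; apply/subsetPset => y [sy /= yt]; split => //=.
    rewrite (le_lt_trans _ yt)// lerD2l lerN2 lef_pV2 ?posrE// ler_nat ltnS//.
rewrite capF measureU; [|exact: measurable_open_cap|exact: measurable_sphere_slice|].
  rewrite [X in (_ + X)%E](_ : _ = 0%E) ?adde0; last exact: sphere_measure_slice1.
  rewrite -[X in _ --> X]fineK ?sphere_measure_fin_num//; last exact: measurable_open_cap.
  move=> /fine_cvg/cvgrPdist_le/(_ _ e0)[k _ /(_ k (leqnn k))].
  by rewrite ler_distl => /andP[+ _]; rewrite lerBlDr => ?; exists (k.+1%:R^-1).
rewrite -subset0 => y [[_ /= yt] [_ /= ty]].
by move: yt; rewrite ty ltxx.
Qed.

(** The inequality defining a cap is strict, so the caps of height [t + 1 / (k + 1)] increase to the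
    whole cap of height [t]. *)
Lemma open_cap_right_continuous d (x : 'rV[R]_d.+1) (t e : R) : 0 < e ->
  exists2 k : R, 0 < k &
  fine (sphere_measure (open_cap x t)) - e <= fine (sphere_measure (open_cap x (t + k))).
Proof.
move=> e0; pose F k := open_cap x (t + k.+1%:R^-1).
have cupF : \bigcup_k F k = open_cap x t.
  apply/seteqP; split=> [y [k _ [sy /= yt]]|y [sy /= yt]].
    by split => //=; rewrite (le_lt_trans _ yt)// lerDl.
  have a0 : 0 < dot x y - t by rewrite subr_gt0.
  have [k _ /(_ k (leqnn k)) /= ka] := near_infty_natSinv_lt (PosNum a0).
  by exists k => //; split => //=; rewrite -ltrBrDl.
have mF k : measurable (F k) by exact: measurable_open_cap.
have : sphere_measure (F k) @[k --> \oo] --> sphere_measure (\bigcup_k F k).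
  apply: nondecreasing_cvg_mu => //.
  - exact: bigcup_measurable.
  - move=> k l kl; apply/subsetPset => y [sy /= yt]; split => //=.
    rewrite (le_lt_trans _ yt)// lerD2l lef_pV2 ?posrE// ler_nat ltnS//.
rewrite cupF -[X in _ --> X]fineK ?sphere_measure_fin_num//; last exact: measurable_open_cap.
move=> /fine_cvg/cvgrPdist_le/(_ _ e0)[k _ /(_ k (leqnn k))].
by rewrite ler_distl => /andP[_ +]; rewrite -lerBlDr => ?; exists (k.+1%:R^-1).
Qed.

Lemma cap_measure_center d (x : 'rV[R]_d.+1) phi : sphere x ->
  fine (sphere_measure (cap x phi)) = cap_measure d phi.
Proof.
move=> x1; congr fine.
have mP := measurable_ray (cos phi).
exact: (sphere_measure_slice mP x1 (sphere_delta0 d)).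
Qed.

(* The cone over a cap centred on the diagonal contains a cube. *)
Lemma cap_measure_gt0 d phi : 0 < phi <= pi -> 0 < cap_measure (R := R) d phi.
Proof.
move=> /andP[phi0 phipi].
have cos1 : cos phi < 1.
  by rewrite -(@cos0 R) ltr_cos// in_itv/= ?lexx ?pi_ge0// ltW.
have cosN1 := cos_geN1 phi.
(* The divisor 3 gives [cos phi < 1 - e] and, as [cos phi >= -1], also [0 < 1 - e]. The diagonal
   unit vector has all coordinates equal to [s]. *)
pose e := (1 - cos phi) / 3; pose s := (Num.sqrt d.+1%:R)^-1 : R.
have s0 : 0 < s by rewrite invr_gt0 sqrtr_gt0.
have ns : d.+1%:R * s ^+ 2 = 1.
  by rewrite exprVn sqr_sqrtr// divff.
pose u : 'rV[R]_d.+1 := const_mx s.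
have sumc (c : R) : \sum_(i < d.+1) c = d.+1%:R * c.
  by rewrite sumr_const card_ord mulr_natl.
have u1 : sphere u.
  rewrite /sphere /= /dot -[RHS]ns -sumc; apply: eq_bigr => i _.
  by rewrite !mxE -expr2.
rewrite -(cap_measure_center _ u1).
have mcap : measurable (cap u phi) by exact: measurable_open_cap.
rewrite fine_gt0// -ge0_fin_numE// sphere_measure_fin_num// andbT.
rewrite /sphere_measure mule_gt0//; last first.
  by rewrite lte_fin invr_gt0 fine_gt0// unit_ball_gt0 unit_ball_lty.
have cube_pos : (0 < lebesgue_rV d.+1 (cube d.+1 ((1 - e) * s)%R s))%E.
  have es : (1 - e) * s < s by rewrite gtr_pMl// /e; lra.
  by rewrite lebesgue_rV_cube ?ltW// lte_fin exprn_gt0// subr_gt0.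
apply: (lt_le_trans cube_pos); apply: le_measure.
- by rewrite inE; exact: measurable_cube.
- by rewrite inE; exact: measurable_cone.
move=> v vc.
have vs i : (1 - e) * s <= v ord0 i <= s by have := vc i; rewrite in_itv.
have e1 : 0 < 1 - e by rewrite /e; lra.
have uv : 1 - e <= dot u v.
  rewrite (_ : 1 - e = d.+1%:R * (s * ((1 - e) * s))); last first.
    by transitivity ((1 - e) * (d.+1%:R * s ^+ 2)); [rewrite ns mulr1 | ring].
  rewrite -sumc; apply: ler_sum => i _; rewrite mxE ler_pM2l//.
  by case/andP: (vs i).
have vv1 : dot v v <= 1.
  rewrite -ns -sumc; apply: ler_sum => i _; have /andP[v1 v2] := vs i.
  have := mulr_gt0 e1 s0; rewrite expr2 => v0.
  by apply: ler_pM => //; lra.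
have vv0 : 0 < dot v v.
  rewrite (lt_le_trans _ (cauchy_schwarz_unit v u1))// exprn_gt0//; lra.
apply/coneP; split=> //; split.
  rewrite /sphere /= dotZ exprVn sqr_sqrtr ?dot_ge0// mulVf// gt_eqF//.
rewrite /= dotZr ltr_pdivlMl ?sqrtr_gt0//.
have r1 : Num.sqrt (dot v v) <= 1 by rewrite -sqrtr1 ler_wsqrtr.
have r0 : 0 < Num.sqrt (dot v v) by rewrite sqrtr_gt0.
(* Since [cos phi] may be negative, the bound [|v| <= 1] is applied to the positive factor [1 - e]
   instead. *)
apply: (@lt_le_trans _ _ (Num.sqrt (dot v v) * (1 - e))).
  by rewrite ltr_pM2l// /e; lra.
by rewrite (le_trans _ uv)// ger_pMl.
Qed.

End slices.

(** * Number variance and equidistribution *)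

Section bounded_probability.
Context d (T : measurableType d) (R : realType) (P : probability T R).
Variables (D : set T) (mD : measurable D).

(** A class closed under sums and products whose members are all integrable; it settles the
    integrability side conditions below. *)
Definition bounded_measurable (f : T -> R) :=
  measurable_fun setT f /\ exists M, forall x, `|f x| <= M.

Lemma bounded_measurable_integrable f :
  bounded_measurable f -> P.-integrable D (EFin \o f).
Proof.
move=> [mf [M fM]]; apply: measurable_bounded_integrable => //.
- by rewrite (le_lt_trans (probability_le1 P mD)) ?ltry.
- exact: measurable_funTS.
- exists M; split; first exact: num_real.
  by move=> M' /ltW MM' x _; rewrite /= (le_trans (fM x)).
Qed.

Lemma bounded_measurable_cst (a : R) : bounded_measurable (fun=> a).
Proof. by split; [exact: measurable_cst|exists `|a|]. Qed.

Lemma bounded_measurable_indic A : measurable A -> bounded_measurable (\1_A).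
Proof.
move=> mA; split; first exact: measurable_indic.
by exists 1 => x; rewrite indicE; case: (_ \in _); rewrite ?normr1 ?normr0.
Qed.

Lemma bounded_measurableD f g : bounded_measurable f -> bounded_measurable g ->
  bounded_measurable (fun x => f x + g x).
Proof.
move=> [mf [M fM]] [mg [M' gM']]; split; first exact: measurable_funD.
by exists (M + M') => x; rewrite (le_trans (ler_normD _ _))// lerD.
Qed.

Lemma bounded_measurableM f g : bounded_measurable f -> bounded_measurable g ->
  bounded_measurable (fun x => f x * g x).
Proof.
move=> [mf [M fM]] [mg [M' gM']]; split; first exact: measurable_funM.
by exists (M * M') => x; rewrite normrM ler_pM.
Qed.

Lemma bounded_measurable_sum I (s : seq I) (f : I -> T -> R) :
  (forall i, bounded_measurable (f i)) ->
  bounded_measurable (fun x => \sum_(i <- s) f i x).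
Proof.
move=> fs; elim: s => [|i s IHs].
  by under eq_fun do rewrite big_nil; exact: bounded_measurable_cst.
by under eq_fun do rewrite big_cons; exact: bounded_measurableD.
Qed.

Lemma Rintegral_sum I (s : seq I) (f : I -> T -> R) :
  (forall i, bounded_measurable (f i)) ->
  \int[P]_(x in D) (\sum_(i <- s) f i x) = \sum_(i <- s) \int[P]_(x in D) f i x.
Proof.
move=> fs; elim: s => [|i s IHs].
  under eq_Rintegral do rewrite big_nil.
  by rewrite big_nil Rintegral_cst// mul0r.
under eq_Rintegral do rewrite big_cons.
rewrite big_cons RintegralD//; first by congr (_ + _).
  exact: bounded_measurable_integrable.
by apply: bounded_measurable_integrable; exact: bounded_measurable_sum.
Qed.

Lemma Rintegral_indic A : measurable A ->
  \int[P]_(x in D) \1_A x = fine (P (A `&` D)).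
Proof. by move=> mA; rewrite /Rintegral integral_indic. Qed.

(* AM-GM in place of Cauchy-Schwarz: [2 |h| <= h ^+ 2 / eta + eta]. *)
Lemma Rintegral_indic_le (h : T -> R) (A : set T) (eta : R) :
  0 < eta -> bounded_measurable h -> measurable A ->
  `|\int[P]_(x in D) (h x * \1_A x)| <=
  ((\int[P]_(x in D) (h x ^+ 2)) / eta + eta) / 2.
Proof.
move=> eta0 hb mA.
(* The AM-GM majorant of [|h|]: the difference is [(|h| - eta) ^+ 2 / (2 * eta)]. *)
pose q x := (2 * eta)^-1 * h x ^+ 2 + eta / 2.
have hb2 : bounded_measurable (fun x => h x ^+ 2).
  by under eq_fun do rewrite expr2; exact: bounded_measurableM.
have hb3 : bounded_measurable (fun x => (2 * eta)^-1 * h x ^+ 2).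
  by apply: bounded_measurableM => //; exact: bounded_measurable_cst.
have qb : bounded_measurable q.
  by apply: bounded_measurableD => //; exact: bounded_measurable_cst.
have hAb : bounded_measurable (fun x => h x * \1_A x).
  by apply: bounded_measurableM => //; exact: bounded_measurable_indic.
have hAq x : `|h x * \1_A x| <= q x.
  have hq : `|h x| <= q x.
    rewrite /q -(real_normK (num_real (h x))) -subr_ge0.
    rewrite (_ : _ - _ = (`|h x| - eta) ^+ 2 / (2 * eta)); last by field; rewrite gt_eqF.
    by rewrite divr_ge0 ?sqr_ge0// mulr_ge0// ltW.
  rewrite normrM indicE; case: (_ \in _); rewrite ?normr1 ?mulr1// normr0 mulr0.
  exact: le_trans hq.
have qI : \int[P]_(x in D) q x <= ((\int[P]_(x in D) (h x ^+ 2)) / eta + eta) / 2.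
  have hI := bounded_measurable_integrable hb2.
  have hI' := bounded_measurable_integrable hb3.
  have cI := bounded_measurable_integrable (bounded_measurable_cst (eta / 2)).
  rewrite RintegralD// (Rintegral_cst P mD (eta / 2)) RintegralZl//.
  have P1 : fine (P D) <= 1.
    by rewrite -lee_fin fineK ?fin_num_measure// probability_le1.
  rewrite [leRHS]mulrDl lerD//; first by rewrite invfM mulrC -mulrA (mulrC 2^-1).
  by rewrite ger_pMr// divr_gt0.
apply: le_trans qI; apply: le_trans (le_normr_Rintegral _ _) _ => //.
  exact: bounded_measurable_integrable.
apply: le_Rintegral => //; last exact: bounded_measurable_integrable.
by have /bounded_measurable_integrable/integrable_norm := hAb.
Qed.

End bounded_probability.

(** Take [k N] to be the largest [i <= N] with [i <= N * g i]; the index 0 always qualifies. Any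
    fixed [K] qualifies for large [N], so [k N] tends to infinity, and so does [N * g (k N) >= k N].
    This provides angles that shrink slowly enough. *)
Lemma slow_index (R : realType) (g : nat -> R) : (forall k, 0 < g k) ->
  exists k : nat -> nat, k @ \oo --> \oo /\
    N%:R * g (k N) @[N --> \oo] --> +oo.
Proof.
move=> g0; pose p N : pred 'I_N.+1 := fun i => (i%:R <= N%:R * g i).
have p0 N : p N ord0 by rewrite /p mulr_ge0// ltW.
pose k N : nat := [arg max_(i > ord0 | p N i) i]%N.
have kP N : (k N)%:R <= N%:R * g (k N).
  by rewrite /k; case: arg_maxnP => // i.
have kK K : \forall N \near \oo, (K <= k N)%N.
  near=> N; have KN : (K < N.+1)%N by rewrite ltnS; near: N; exact: nbhs_infty_ge.
  rewrite /k; case: arg_maxnP => // i _ /(_ (Ordinal KN)); apply.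
  rewrite /p/= -ler_pdivrMr//; near: N.
  exact: nbhs_infty_ger.
exists k; split; first exact/cvgnyPge.
apply/cvgryPge => A; near=> N.
apply: le_trans (kP N); rewrite (le_trans (ler_norm A))//.
rewrite (le_trans (ltW (archi_boundP (normr_ge0 A))))// ler_nat.
near: N; exact: kK.
Unshelve. all: by end_near.
Qed.

(** * Exchanging centres and points *)

Section counting.
Context {R : realType} {d : nat}.
Implicit Types (X : {fset 'rV[R]_d.+1}) (x p : 'rV[R]_d.+1) (A : set 'rV[R]_d.+1).

Lemma npointsE X A : (npoints X A)%:R = \sum_(p <- X) \1_A p :> R.
Proof.
rewrite /npoints card_fset_sum1 -big_fset_condE/= natr_sum big_mkcond.
by apply: eq_bigr => p _; rewrite indicE; case: (p \in A).
Qed.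

Lemma capC x p phi : sphere x -> sphere p -> cap x phi p <-> cap p phi x.
Proof. by move=> x1 p1; split=> -[_]; rewrite dotC; split. Qed.

Lemma measurable_cap x phi : measurable (cap x phi).
Proof. exact: measurable_open_cap. Qed.

Let sigma (A : set 'rV[R]_d.+1) : R := fine (sphere_measure A).

(** The left-hand side is the absolute integral over [A] of the counting discrepancy, whose mean
    square is the number variance. *)
Lemma sum_cap_sub_le X phi eta A :
  (forall p, p \in X -> sphere p) -> 0 < eta ->
  measurable A -> A `<=` @sphere R d.+1 ->
  `|\sum_(p <- X) sigma (cap p phi `&` A)
    - #|` X|%fset%:R * cap_measure d phi * sigma A| <=
  (number_variance X phi / eta + eta) / 2.
Proof.
move=> XS eta0 mA AS; set a := _ * cap_measure d phi.
pose c x := \sum_(p <- X) (\1_(cap p phi) x : R).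
pose h x := c x + - a.
have cb : bounded_measurable c.
  apply: bounded_measurable_sum => p; apply: bounded_measurable_indic.
  exact: measurable_cap.
have hb : bounded_measurable h.
  by apply: bounded_measurableD => //; exact: bounded_measurable_cst.
have mS := @measurable_sphere R d.+1.
(* On the sphere, [p] lies in the cap around [x] iff [x] lies in the cap around [p]; so [c x] counts
   the points of [X] in the cap around [x]. *)
have -> : number_variance X phi =
    \int[@sphere_measure R d.+1]_(x in @sphere R d.+1) (h x ^+ 2).
  apply: eq_Rintegral => x; rewrite inE => x1; rewrite npointsE.
  congr ((_ - _) ^+ 2); rewrite [LHS]big_seq [RHS]big_seq.
  apply: eq_bigr => p /XS p1; rewrite !indicE; congr (_%:R).
  by congr (nat_of_bool _); apply/idP/idP; rewrite !inE capC.
apply: le_trans (Rintegral_indic_le (@sphere_measure R d.+1) mS eta0 hb mA).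
(* Both absolute values are equal: the integral of [h] over [A] is computed term by term. *)
rewrite le_eqVlt; apply/orP; left; apply/eqP; congr `|_|.
have indI p x : \1_(cap p phi) x * \1_A x = \1_(cap p phi `&` A) x :> R.
  by rewrite indicI.
have hE x : h x * \1_A x = \sum_(p <- X) (\1_(cap p phi `&` A) x) - a * \1_A x.
  rewrite /h mulrBl mulr_suml; congr (_ - _).
  by apply: eq_bigr => p _; exact: indI.
have bA := @bounded_measurable_indic _ _ R _ mA.
have bI p : bounded_measurable (\1_(cap p phi `&` A) : _ -> R).
  by apply: bounded_measurable_indic; apply: measurableI => //; exact: measurable_cap.
under [RHS]eq_Rintegral do rewrite hE.
rewrite RintegralB//; last 2 first.
- by apply: bounded_measurable_integrable => //; exact: bounded_measurable_sum.
- apply: bounded_measurable_integrable => //; apply: bounded_measurableM => //.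
  exact: bounded_measurable_cst.
rewrite Rintegral_sum// RintegralZl//; last exact: bounded_measurable_integrable.
rewrite Rintegral_indic// (setIidl AS); congr (_ - _).
apply: eq_bigr => p _; rewrite Rintegral_indic//.
  have IS : cap p phi `&` A `<=` @sphere R d.+1 by move=> y [_ /AS].
  by rewrite (setIidl IS).
by apply: measurableI => //; exact: (measurable_cap p phi).
Qed.

Lemma open_cap_perturb x p y phi (delta : R) :
  sphere x -> sphere p -> 0 < delta -> 2 * (1 - cos phi) < delta ^+ 2 ->
  cap p phi y -> `|dot x p - dot x y| < delta.
Proof.
move=> x1 p1 delta0 phid [y1 py].
rewrite -(ltr_pXn2r (n := 2)) ?nnegrE ?normr_ge0 ?ltW// real_normK ?num_real//.
by rewrite (le_lt_trans (dot_sphere_dist x1 p1 y1))//; lra.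
Qed.

End counting.

(** * Squeezing the counts between two caps *)

Section uniform.
Context {R : realType} {d : nat}.
Variables (X : nat -> {fset 'rV[R]_d.+1}).
Hypotheses (d0 : (0 < d)%N) (XS : forall N p, p \in X N -> sphere p).
Hypothesis cardX : forall N, #|` X N|%fset = N.

Let sigma (A : set 'rV[R]_d.+1) : R := fine (sphere_measure A).

Let le_sigma (A B : set 'rV[R]_d.+1) : measurable A -> measurable B -> A `<=` B ->
  sigma A <= sigma B.
Proof.
move=> mA mB AB; rewrite fine_le ?sphere_measure_fin_num//.
by apply: le_measure => //; rewrite inE.
Qed.

Let count N x phi : R := (npoints (X N) (cap x phi))%:R.

(** Multiplied by [s], the count is a sum of [s * \1_(cap x phi) p], to be compared with the areas
    that small caps around the points cut out of a cap of height [cos phi + k] or [cos phi - k]. The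
    variance hypothesis is [sum_cap_sub_le] with [eta = N * s * e], and bounds the error by
    [eta]. *)
Let count_between N x phi psi k e : sphere x -> 0 < k ->
  2 * (1 - cos psi) < k ^+ 2 -> 0 < cap_measure (R := R) d psi ->
  (number_variance (X N) psi / (N%:R * cap_measure d psi * e) +
    N%:R * cap_measure d psi * e) / 2 <= N%:R * cap_measure d psi * e ->
  0 < e -> (0 < N)%N ->
  N%:R * (sigma (open_cap x (cos phi + k)) - e) <= count N x phi <=
  N%:R * (sigma (open_cap x (cos phi - k)) + e).
Proof.
move=> x1 k0 psik s0 Ve e0 N0; set s := cap_measure d psi in s0 Ve *.
have Ns0 : 0 < N%:R * s * e by rewrite !mulr_gt0// ltr0n.
have close t : `|\sum_(p <- X N) sigma (cap p psi `&` open_cap x t)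
    - N%:R * s * sigma (open_cap x t)| <= N%:R * s * e.
  rewrite -[X in X%:R * s * sigma _](cardX N); apply: le_trans Ve.
  by apply: sum_cap_sub_le => // [p /XS//||y []//]; exact: measurable_open_cap.
have sumE : s * count N x phi = \sum_(p <- X N) s * \1_(cap x phi) p.
  by rewrite /count npointsE mulr_sumr.
have mcap p : measurable (cap p psi) by exact: measurable_open_cap.
have mI p t : measurable (cap p psi `&` open_cap x t).
  by apply: measurableI => //; exact: measurable_open_cap.
have sE p : sphere p -> s = sigma (cap p psi).
  by move=> p1; rewrite /sigma cap_measure_center.
have near_cap p y : sphere p -> cap p psi y -> `|dot x p - dot x y| < k.
  by move=> p1; exact: open_cap_perturb.
rewrite -(ler_pM2l s0) -[X in _ && X](ler_pM2l s0) sumE; apply/andP; split.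
- have := close (cos phi + k); rewrite ler_distl => /andP[lo _].
  rewrite (_ : s * _ = N%:R * s * sigma (open_cap x (cos phi + k)) - N%:R * s * e).
    apply: (@le_trans _ _
        (\sum_(p <- X N) sigma (cap p psi `&` open_cap x (cos phi + k)))).
      move: (close (cos phi + k)); rewrite distrC ler_distl => /andP[_ ].
      by rewrite lerBlDr.
    rewrite big_seq [leRHS]big_seq; apply: ler_sum => p /XS p1.
    (* For [p] outside the cap, its small cap stays below height [cos phi + k], so the intersection
       is empty. *)
    rewrite indicE; case: (boolP (p \in _)) => [_|/negP pc].
      by rewrite mulr1 (sE p)// le_sigma.
    rewrite mulr0 /sigma (_ : _ `&` _ = set0) ?measure0// -subset0 => y [py [_ /= xy]].
    apply: pc; rewrite inE; split => //.
    have := near_cap _ _ p1 py; rewrite ltr_norml => /andP[? ?]; lra.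
  ring.
- have := close (cos phi - k); rewrite ler_distl => /andP[_ hi].
  rewrite (_ : s * (_ * _) = N%:R * s * sigma (open_cap x (cos phi - k)) + N%:R * s * e);
    last by ring.
  apply: le_trans hi.
  rewrite big_seq [leRHS]big_seq; apply: ler_sum => p /XS p1.
  rewrite indicE; case: (boolP (p \in _)) => [|_]; last by rewrite mulr0 fine_ge0.
  (* For [p] inside the cap, its small cap lies entirely above height [cos phi - k], so its whole
     area [s] is counted. *)
  rewrite inE => -[_ /= xp]; rewrite mulr1 (sE p)// le_sigma// => y py; split => //.
  split; first by case: py.
  have := near_cap _ _ p1 py; rewrite ltr_norml /= => /andP[? ?]; lra.
Qed.


Lemma uniformly_distributed_of_hyperuniform :
  hyperuniform_small_caps X -> uniformly_distributed X.
Proof.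
move=> hyper x phi x1 _.
pose u (j : nat) : R := j.+1%:R^-1.
have u0 j : 0 < u j by rewrite invr_gt0.
have u_pi j : u j <= pi.
  rewrite (@le_trans _ _ 1)// /u ?invf_le1 ?ler1n//.
  by rewrite (le_trans _ (pi_ge2 R))// ler1n.
have s0 j : 0 < cap_measure (R := R) d (u j).
  by apply: cap_measure_gt0; rewrite u0 u_pi.
(* The angles [u (k N)] tend to 0 so slowly that the expected number of points per cap still tends
   to infinity. *)
have [k [k_oo Ns_oo]] := slow_index s0.
pose psi N := u (k N).
have psi0 : psi @ \oo --> (0 : R).
  apply: (cvg_comp k u k_oo); exact: cvg_harmonic.
have cos1 : cos (psi N) @[N --> \oo] --> (1 : R).
  by rewrite -(@cos0 R); apply: (cvg_comp psi cos psi0); exact: continuous_cos.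
(* The little-o bound is used with constant 1: eventually the variance is at most [D]. *)
have /eqoP/(_ 1 ltr01) Vo := hyper psi
  (fun N => introT andP (conj (ltW (u0 (k N))) (u_pi (k N)))) psi0 Ns_oo.
have near_cos (e : R) : 0 < e -> \forall N \near \oo, 2 * (1 - cos (psi N)) < e ^+ 2.
  move=> e0; have e2 : 0 < e ^+ 2 / 2 by rewrite divr_gt0// exprn_gt0.
  move/cvgrPdist_lt : cos1 => /(_ _ e2); apply: filterS => N /ltr_normlW ?; lra.
apply/cvgrPdist_le => e e0.
have e20 : 0 < e / 2 by rewrite divr_gt0.
have [k1 k10 up] := open_cap_left_continuous (cos phi) d0 x1 e20.
have [k2 k20 lo] := open_cap_right_continuous x (cos phi) e20.
near=> N.
have N0 : (0 < N)%N by near: N; exact: nbhs_infty_gt.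
have sN : 0 < cap_measure (R := R) d (psi N) by exact: s0.
set D := N%:R * cap_measure d (psi N).
have D0 : 0 < D by rewrite mulr_gt0// ltr0n.
have VD : number_variance (X N) (psi N) <= D.
  apply: le_trans (ler_norm _) _; rewrite -[leRHS]mul1r -[X in 1 * X]gtr0_norm//.
  by rewrite /D; near: N; exact: Vo.
(* Chosen so that [D <= (D * (e / 2)) ^+ 2]; with [VD] this yields the variance hypothesis of
   [count_between] for the error [e / 2]. *)
have De : (e / 2) ^- 2 <= D.
  by rewrite /D; near: N; move/cvgryPge : Ns_oo; exact.
have Ve : (number_variance (X N) (psi N) / (D * (e / 2)) + D * (e / 2)) / 2 <= D * (e / 2).
  suff : number_variance (X N) (psi N) / (D * (e / 2)) <= D * (e / 2) by lra.
  rewrite ler_pdivrMr; last exact: mulr_gt0.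
  apply: le_trans VD _.
  rewrite [leRHS](_ : _ = D * (D * (e / 2) ^+ 2)); last by ring.
  apply: ler_peMr; first exact: ltW.
  by rewrite -ler_pdivrMr ?exprn_gt0// mul1r.
have c1 : 2 * (1 - cos (psi N)) < k1 ^+ 2 by near: N; exact: near_cos.
have c2 : 2 * (1 - cos (psi N)) < k2 ^+ 2 by near: N; exact: near_cos.
have /andP[_ hi1] := count_between phi x1 k10 c1 sN Ve e20 N0.
have /andP[lo1 _] := count_between phi x1 k20 c2 sN Ve e20 N0.
have Nr : 0 < N%:R :> R by rewrite ltr0n.
rewrite ler_distlC; apply/andP; split.
- rewrite ler_pdivlMl//; apply: le_trans lo1; rewrite ler_pM2l//.
  by move: lo; rewrite /sigma; change (cap x phi) with (open_cap x (cos phi)); lra.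
- rewrite ler_pdivrMl//; apply: (le_trans hi1); rewrite ler_pM2l//.
  by move: up; rewrite /sigma; change (cap x phi) with (open_cap x (cos phi)); lra.
Unshelve. all: by end_near.
Qed.

End uniform.

Theorem theorem2 (R : realType) (d : nat) (hd : (1 <= d)%N)
    (X : nat -> {fset 'rV[R]_d.+1})
    (XS : forall N x, x \in X N -> @sphere R d.+1 x)
    (cardX : forall N, #|` X N|%fset = N)
    (hyper : hyperuniform_small_caps X) :
  uniformly_distributed X.
Proof. exact: uniformly_distributed_of_hyperuniform. Qed.
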